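(* Let $p,q\in\mathbb{N}$ and let $A$ be a bounded operator on a complex Hilbert space $\mathcal{H}$ such that $(A^* )^sA^s=(A^*A)^s$ for all $s\in\{p,\,q,\,p+q,\,2p,\,2p+q\}$. Then $A$ is quasinormal.
   Context: $\mathbb{N}$ denotes the set of positive integers. A bounded operator $A$ on a complex Hilbert space is called quasinormal if $A(A^*A)=(A^*A)A$. *)

(* Defs.v *)
From HB Require Import structures.
From mathcomp Require Import all_boot all_order all_algebra.
From mathcomp Require Import complex ring lra.
From mathcomp Require Import all_classical all_reals all_analysis.

Set Implicit Arguments.
Unset Strict Implicit.
Unset Printing Implicit Defensive.

Import Order.TTheory GRing.Theory Num.Theory Num.Def.
Import numFieldNormedType.Exports.

Local Open Scope classical_set_scope.
Local Open Scope complex_scope.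
Local Open Scope ring_scope.

(* The norm of a normedModType over R[i] takes its values in R[i]; the library
   order on R[i] makes it a nonnegative real. A form in {dot H for conjC} is
   linear in its first argument and conjugate-linear in the second. *)
HB.mixin Record CompleteNormedModule_isHilbert (R : realType) H
    of CompleteNormedModule R[i] H := {
  inner : {dot H for conjC};
  inner_normE : forall x : H, `|x| ^+ 2 = inner x x
}.

#[short(type="hilbertType")]
HB.structure Definition Hilbert (R : realType) :=
  {H of CompleteNormedModule_isHilbert R H & CompleteNormedModule R[i] H}.

(* Total on arbitrary maps; adjointP below shows that for a bounded linear A it
   is the Hilbert space adjoint: the value at y is the (unique) vector z with
   <A x, y> = <x, z> for all x. *)
Definition adjoint (R : realType) (H : hilbertType R) (A : H -> H) (y : H) : H :=
  xget 0 [set z | forall x, inner (A x) y = inner x z].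

Section Riesz.
Variables (R : realType) (H : hilbertType R).
Implicit Types x y z h u v : H.
Local Notation "''[' u , v ]" := (inner u v) : ring_scope.
Let sqn x : R := complex.Re '[x, x].
Let sqnE x : (sqn x)%:C = '[x, x].
Proof. by rewrite RRe_real// ger0_real// dnorm_ge0. Qed.
Let normE x : `|x| = (Num.sqrt (sqn x))%:C.
Proof.
apply/eqP; rewrite -(@eqrXn2 _ 2)//; last by rewrite lecR sqrtr_ge0.
rewrite inner_normE -rmorphXn/= sqr_sqrtr -?sqnE//.
by rewrite -lecR sqnE dnorm_ge0.
Qed.
Let sqn_ge0 x : 0 <= sqn x. Proof. by rewrite -lecR sqnE dnorm_ge0. Qed.

Let parallelogram x y : sqn (x - y) = 2 * sqn x + 2 * sqn y - sqn (x + y).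
Proof.
apply: (@complexI R); rewrite !(rmorphB, rmorphD, rmorphM, rmorph_nat)/= !sqnE dnormB dnormD.
set a := '[x,x]; set b := '[y, y]; set c := _ + _^*.
ring.
Qed.

Let projE u v : v != 0 ->
  let a := '[u, v] / '[v, v] in
  '[u - a *: v, u - a *: v] = '[u, u] - `|'[u, v]| ^+ 2 / '[v, v].
Proof.
move=> v0 a; have v_neq0 : '[v, v] != 0 by rewrite dnorm_eq0.
rewrite dnormB dnormZ linearZr_LR/= /a.
set b := '[u, v]; set c := '[v, v].
have cJ : conjC c = c by apply/CrealP; rewrite ger0_real// dnorm_ge0.
have c0 : 0 <= c by exact: dnorm_ge0.
rewrite !rmorphM/= conjCK !fmorphV/= cJ normrM normfV (ger0_norm c0) (normCK b).
by rewrite expr_div_n normCK cJ; field.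
Qed.

Let cauchy_schwarz u v : `|'[u, v]| <= `|u| * `|v|.
Proof.
have [->|v0] := eqVneq v 0; first by rewrite linear0r !normr0 mulr0.
rewrite -(@ler_pXn2r _ 2)// ?nnegrE ?mulr_ge0// exprMn !inner_normE.
rewrite -ler_pdivrMr ?dnorm_gt0//.
by rewrite -subr_ge0 -projE//= dnorm_ge0.
Qed.

Let riesz (f : H -> R[i]) (M : R[i]) :
  (forall a x y, f (a *: x + y) = a * f x + f y) ->
  (forall x, `|f x| <= M * `|x|) ->
  exists z, forall x, f x = '[x, z].
Proof.
move=> flin fM.
have [f0|/existsNP[x0 /eqP fx0]] := pselect (forall x, f x = 0).
  by exists 0 => x; rewrite f0 linear0r.
have fZ a x : f (a *: x) = a * f x.
  have f00 : f 0 = 0.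
    by have := flin 1 0 0; rewrite scaler0 addr0 mul1r => /esym/(canRL (addrK _)); rewrite subrr.
  by rewrite -[a *: x]addr0 flin f00 addr0.
have fD x y : f (x + y) = f x + f y by rewrite -{1}[x]scale1r flin mul1r.
have fB x y : f (x - y) = f x - f y by rewrite fD -scaleN1r fZ mulN1r.
have f00 : f 0 = 0 by rewrite -(subrr 0) fB subrr.
pose S := sqn @` [set x | f x = 1].
have S0 : S !=set0.
  by exists (sqn ((f x0)^-1 *: x0)), ((f x0)^-1 *: x0) => //=; rewrite fZ mulVf.
have lbS : has_lbound S by exists 0 => _ [x _ <-].
pose D := inf S.
have DS x : f x = 1 -> D <= sqn x by move=> fx; apply: ge_inf => //; exists x.
have Dh (t : R) : 0 < t -> exists2 x, f x = 1 & sqn x < D + t.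
  by move=> t0; have [_ [y fy <-]] := inf_adherent t0 (conj S0 lbS); exists y.
pose B (t : R) := [set x | f x = 1 /\ sqn x < D + t].
pose F := filter_from [set t : R | 0 < t] B.
have FF : ProperFilter F.
  apply: filter_from_proper; last by move=> t /Dh[x fx Dx]; exists x.
  apply: filter_from_filter; first by exists 1 => /=.
  move=> i j i0 j0; exists (Num.min i j); first by rewrite /= lt_min i0.
  by move=> x [fx]; rewrite -ltrBlDl lt_min => /andP[? ?]; split; split => //; rewrite -ltrBlDl.
have cF : cauchy F.
  apply/cauchy_ballP => e e0.
  have eE : e = (complex.Re e)%:C by rewrite RRe_real// gtr0_real.
  set r := complex.Re e in eE; have r0 : 0 < r by rewrite -ltcR -eE.
  exists (B (r ^+ 2 / 4), B (r ^+ 2 / 4)).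
    by split; exists (r ^+ 2 / 4) => //=; rewrite divr_gt0 ?exprn_gt0.
  move=> [x y] /= [[fx sx] [fy sy]]; rewrite -ball_normE/= eE.
  rewrite normE ltcR -(ger0_norm (ltW r0)) -sqrtr_sqr ltr_sqrt ?exprn_gt0//.
  rewrite parallelogram.
  have : D <= sqn (2^-1 *: (x + y)).
    by apply: DS; rewrite fZ fD fx fy -(natrD _ 1 1) mulVf.
  have -> : sqn (2^-1 *: (x + y)) = 4^-1 * sqn (x + y).
    apply: (@complexI R); rewrite rmorphM/= !sqnE dnormZ fmorphV rmorph_nat.
    rewrite normfV normr_nat; congr (_ * _); by field.
  move: sx sy; move: (sqn x) (sqn y) (sqn (x + y)) (D) (r ^+ 2); clear=> a b c d s.
  by move=> ? ? ?; lra.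
have [z Fz] : exists z, F --> z by apply/cvg_ex; exact: cauchy_cvg.
have near_z (e : R) : 0 < e -> exists x, [/\ f x = 1, sqn x < D + e ^+ 2 & `|z - x| < e%:C].
  move=> e0.
  have : F (ball z e%:C `&` B (e ^+ 2)).
    apply: filterI; first by apply: Fz; apply: nbhsx_ballx; rewrite ltcR.
    by exists (e ^+ 2) => //=; rewrite exprn_gt0.
  by move=> /filter_ex[x []]; rewrite -ball_normE/= => ? [? ?]; exists x.
have M0 : 0 <= M.
  have := fM x0; have [x00|x00 h] := eqVneq x0 0.
    by move: fx0; rewrite x00 f00 eqxx.
  by rewrite -(pmulr_lge0 _ (_ : 0 < `|x0|)) ?normr_gt0// (le_trans _ h).
have small (w K : R[i]) : 0 <= K -> (forall e : R, 0 < e -> `|w| <= K * e%:C) -> w = 0.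
  move=> K0 wK; apply/eqP/negPn/negP => w0.
  pose k := complex.Re K; pose v := complex.Re `|w|.
  have kE : K = k%:C by rewrite RRe_real// ger0_real.
  have vE : `|w| = v%:C by rewrite RRe_real// ger0_real.
  have k0 : 0 <= k by rewrite -lecR -kE.
  have v0 : 0 < v by rewrite -ltcR -vE normr_gt0.
  have k10 : 0 < k + 1 by rewrite ltr_wpDl.
  have /wK : 0 < v / (k + 1) by rewrite divr_gt0.
  rewrite vE kE -rmorphM lecR mulrA ler_pdivlMr// mulrC.
  by rewrite ler_pM2r// gerDl ler10.
have fz : f z = 1.
  apply/eqP; rewrite -subr_eq0; apply/eqP/(small _ M M0) => e /near_z[x [<- _ zx]].
  by rewrite -fB (le_trans (fM _))// ler_wpM2l// ltW.
have zh h : f h = 0 -> '[z, h] = 0.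
  move=> fh; have [->|h0] := eqVneq h 0; first by rewrite linear0r.
  apply: (small _ (2 * `|h|)); first by rewrite mulr_ge0.
  move=> e e0; have [x [fx sx zx]] := near_z _ e0.
  have xh : `|'[x, h]| <= e%:C * `|h|.
    rewrite -(@ler_pXn2r _ 2)// ?nnegrE ?mulr_ge0 ?lecR ?(ltW e0)//.
    rewrite exprMn inner_normE -ler_pdivrMr ?dnorm_gt0//.
    have := projE x h0 => /=; set a := _ / _ => pE.
    have : D <= sqn (x - a *: h) by apply: DS; rewrite fB fZ fh mulr0 subr0.
    rewrite -lecR sqnE pE -sqnE lerBrDr -lerBrDl => /le_trans; apply.
    by rewrite -rmorphB -rmorphXn lecR lerBlDl ltW.
  rewrite -(subrK x z) linearDl (le_trans (ler_normD _ _))// mulr2n mulrDl mul1r mulrDl.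
  rewrite lerD//; last by rewrite mulrC.
  by rewrite (le_trans (cauchy_schwarz _ _))// mulrC ler_wpM2l// ltW.
have z0 : '[z, z] != 0.
  by rewrite dnorm_eq0; apply: contra_eq_neq fz => ->; rewrite f00 eq_sym oner_eq0.
have zzJ : conjC '[z, z] = '[z, z] by apply/CrealP; rewrite ger0_real// dnorm_ge0.
exists ('[z, z]^-1 *: z) => x; rewrite linearZr_LR/= fmorphV/= zzJ.
have /zh : f (x - f x *: z) = 0 by rewrite fB fZ fz mulr1 subrr.
move=> /(congr1 conjC); rewrite rmorph0.
have := hermC inner (x - f x *: z) z; rewrite mul1r => <-.
rewrite linearBl linearZl_LR/= => /eqP; rewrite subr_eq0 => /eqP ->.
by rewrite mulrC mulfK.
Qed.

Lemma adjointP (A : {linear H -> H}) : bounded_near A (nbhs (0 : H)) ->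
  forall x y, inner (A x) y = inner x (adjoint A y).
Proof.
move=> /linear_boundedP [r [_ /(_ (r + 1)) Ar]] x y.
have := @xgetPex _ 0 [set z | forall x, inner (A x) y = inner x z]; apply.
have {}Ar : forall x, `|A x| <= (r + 1) * `|x| by apply: Ar; rewrite ltrDl.
apply: (@riesz _ ((r + 1) * `|y|)) => [a u v|u].
  by rewrite linearP linearDl linearZl_LR.
by rewrite (le_trans (cauchy_schwarz _ _))// mulrAC ler_wpM2r.
Qed.
End Riesz.

Definition quasinormal (R : realType) (H : hilbertType R) (A : H -> H) :=
  A \o (adjoint A \o A) =1 (adjoint A \o A) \o A.

(* Main.v *)
(* Write T = A^* A. The five hypotheses give D^* D = 0 for
   D = T^p A^q - A^q T^p, so T^p commutes with A^q, hence so does its positive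
   root T. Then A^{*s} A^s = T^s implies A^{*(s+q)} A^{s+q} = T^(s+q); starting
   from s = 1 and s = q, the hypotheses hold with (q, 1) in place of (p, q), and
   the same argument shows that T commutes with A.

   That an operator B commuting with T^p commutes with T >= 0 needs no spectral
   theorem: scale T so that T <= 1 and iterate z_0 = 0,
   z_{n+1} = z_n + (t^p - z_n^p) / p, a sequence of polynomials in t^p. The error
   e_n = t - z_n stays in the cone generated by products of t and 1 - t, on which
   evaluation at T is positive, and so does p - n e_n^m for m >= p. Hence
   n <e_n(T)^m x, x> <= p ||x||^2, so e_n(T) -> 0 strongly, and B T - T B =
   B e_n(T) - e_n(T) B -> 0. *)

Require Import Defs.
From HB Require Import structures.
From mathcomp Require Import all_boot all_order all_algebra.
From mathcomp Require Import complex.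
From mathcomp Require Import all_classical all_reals all_analysis.
From mathcomp Require Import ring.

Set Implicit Arguments.
Unset Strict Implicit.
Unset Printing Implicit Defensive.

Import Order.TTheory GRing.Theory Num.Theory Num.Def.
Import numFieldNormedType.Exports.

Local Open Scope classical_set_scope.
Local Open Scope ring_scope.

(** * Polynomial calculus of a linear operator *)

Section EvalOp.
Variables (K : comNzRingType) (V : lmodType K) (T : {linear V -> V}).
Implicit Types (f g : {poly K}) (x : V) (c : K).

Definition evalop f x : V := \sum_(i < size f) f`_i *: iter i T x.

Lemma evalop_widen n f x : (size f <= n)%N ->
  evalop f x = \sum_(i < n) f`_i *: iter i T x.
Proof.
move=> fn; rewrite /evalop (big_ord_widen n (fun i => f`_i *: iter i T x) fn).
rewrite big_mkcond; apply: eq_bigr => i _.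
by case: ltnP => // /leq_sizeP -> //; rewrite scale0r.
Qed.

Lemma evalopD f g x : evalop (f + g) x = evalop f x + evalop g x.
Proof.
rewrite !(@evalop_widen (maxn (size f) (size g))) ?leq_maxl ?leq_maxr ?size_polyD//.
by rewrite -big_split; apply: eq_bigr => i _; rewrite coefD scalerDl.
Qed.

Lemma evalopZ c f x : evalop (c *: f) x = c *: evalop f x.
Proof.
rewrite (@evalop_widen (size f)) ?size_scale_leq// scaler_sumr.
by apply: eq_bigr => i _; rewrite coefZ scalerA.
Qed.

Lemma evalopB f g x : evalop (f - g) x = evalop f x - evalop g x.
Proof. by rewrite evalopD -(scaleN1r g) evalopZ scaleN1r. Qed.

Lemma evalopC c x : evalop c%:P x = c *: x.
Proof. by rewrite (@evalop_widen 1) ?size_polyC_leq1// big_ord1 coefC. Qed.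

Lemma evalop0 x : evalop 0 x = 0.
Proof. by rewrite -polyC0 evalopC scale0r. Qed.

Lemma evalopMX f x : evalop (f * 'X) x = T (evalop f x).
Proof.
rewrite (@evalop_widen (size f).+1) ?size_mulX_leq//; last first.
  have [->|f0] := eqVneq f 0; first by rewrite mul0r size_poly0.
  by rewrite size_mulX.
rewrite big_ord_recl coefMX scale0r add0r linear_sum.
by apply: eq_bigr => i _; rewrite coefMX linearZ.
Qed.

Lemma evalopX x : evalop 'X x = T x.
Proof. by rewrite -(mul1r 'X) evalopMX -polyC1 evalopC scale1r. Qed.

Lemma evalopM f g x : evalop (f * g) x = evalop f (evalop g x).
Proof.
elim/poly_ind: f => [|f c IHf]; first by rewrite mul0r !evalop0.
rewrite mulrDl mulrAC mul_polyC evalopD evalopMX evalopZ IHf.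
by rewrite evalopD evalopMX evalopC.
Qed.

Lemma evalopXn n x : evalop ('X ^+ n) x = iter n T x.
Proof.
elim: n => [|n IHn]; first by rewrite expr0 -polyC1 evalopC scale1r.
by rewrite exprSr evalopMX IHn.
Qed.

Section Commute.
Variable B : {linear V -> V}.

(** These polynomials form a subalgebra. It will contain ['X ^+ p] by assumption, and the aim is the
    commutation of [B] with [T] itself. *)
Definition evalop_comm f := forall x, B (evalop f x) = evalop f (B x).

Lemma evalop_commD f g : evalop_comm f -> evalop_comm g -> evalop_comm (f + g).
Proof. by move=> Cf Cg x; rewrite !evalopD linearD Cf Cg. Qed.

Lemma evalop_commZ c f : evalop_comm f -> evalop_comm (c *: f).
Proof. by move=> Cf x; rewrite !evalopZ linearZ_LR Cf. Qed.

Lemma evalop_commM f g : evalop_comm f -> evalop_comm g -> evalop_comm (f * g).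
Proof. by move=> Cf Cg x; rewrite !evalopM Cf Cg. Qed.

Lemma evalop_commC c : evalop_comm c%:P.
Proof. by move=> x; rewrite !evalopC linearZ_LR. Qed.

Lemma evalop_commXn f n : evalop_comm f -> evalop_comm (f ^+ n).
Proof.
move=> Cf; elim: n => [|n IHn]; first exact: (@evalop_commC 1).
by rewrite exprS; apply: evalop_commM.
Qed.

End Commute.
End EvalOp.

(** * The cone generated by products of t and 1 - t *)

Section Cone.
Variable K : numFieldType.
Implicit Types (f g z : {poly K}) (c : K).

(** Certificates of nonnegativity on [0, 1] that transfer to operators with 0 <= T <= 1. Below,
    [cone (g - f)] plays the role of f <= g. *)
Inductive cone : {poly K} -> Prop :=
| coneC c : 0 <= c -> cone c%:P
| coneD f g : cone f -> cone g -> cone (f + g)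
| coneXM f : cone f -> cone ('X * f)
| coneX1M f : cone f -> cone ((1 - 'X) * f).

Lemma coneM f g : cone f -> cone g -> cone (f * g).
Proof.
move=> + cg; elim=> [c c0|f1 f2 _ h1 _ h2|f1 _ h1|f1 _ h1].
- elim: cg => [d d0|f1 f2 _ h1 _ h2|f1 _ h1|f1 _ h1].
  + by rewrite -polyCM; apply: coneC; rewrite mulr_ge0.
  + by rewrite mulrDr; apply: coneD.
  + by rewrite mulrCA; apply: coneXM.
  + by rewrite mulrCA; apply: coneX1M.
- by rewrite mulrDl; apply: coneD.
- by rewrite -mulrA; apply: coneXM.
- by rewrite -mulrA; apply: coneX1M.
Qed.

Lemma cone0 : cone 0. Proof. by rewrite -polyC0; apply: coneC. Qed.

Lemma cone1 : cone 1. Proof. by rewrite -polyC1; apply: coneC. Qed.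

Lemma coneX : cone 'X.
Proof. by rewrite -(mulr1 'X); apply/coneXM/cone1. Qed.

Lemma coneX1 : cone (1 - 'X).
Proof. by rewrite -(mulr1 (1 - 'X)); apply/coneX1M/cone1. Qed.

Lemma coneMn f n : cone f -> cone (f *+ n).
Proof.
move=> cf; elim: n => [|n IHn]; first by rewrite mulr0n; exact: cone0.
by rewrite mulrS; apply: coneD.
Qed.

Lemma coneZ c f : 0 <= c -> cone f -> cone (c *: f).
Proof. by move=> c0 cf; rewrite -mul_polyC; apply: coneM => //; apply: coneC. Qed.

Lemma coneXn f n : cone f -> cone (f ^+ n).
Proof.
move=> cf; elim: n => [|n IHn]; first by rewrite expr0; exact: cone1.
by rewrite exprS; apply: coneM.
Qed.

Lemma cone_sum n (F : 'I_n -> {poly K}) :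
  (forall i, cone (F i)) -> cone (\sum_(i < n) F i).
Proof. by move=> cF; apply: big_ind => //; [exact: cone0|exact: coneD]. Qed.

Lemma cone_1subM f g : cone f -> cone (1 - f) -> cone (1 - g) -> cone (1 - f * g).
Proof.
move=> cf cf1 cg1; have -> : 1 - f * g = (1 - f) + f * (1 - g) by ring.
by apply: coneD => //; apply: coneM.
Qed.

Lemma cone_1subXn f n : cone f -> cone (1 - f) -> cone (1 - f ^+ n).
Proof.
move=> cf cf1; elim: n => [|n IHn]; first by rewrite expr0 subrr; exact: cone0.
by rewrite exprS; apply: cone_1subM.
Qed.

Lemma cone_subXn f g n : cone f -> cone g -> cone (f - g) -> cone (f ^+ n - g ^+ n).
Proof.
move=> cf cg cfg; rewrite subrXX; apply: coneM => //; apply: cone_sum => i.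
by apply: coneM; apply: coneXn.
Qed.

(** * Iteration recovering t from t^p *)

Fixpoint root_iter p n : {poly K} :=
  if n is n'.+1 then
    let z := root_iter p n' in z + p%:R^-1 *: ('X ^+ p - z ^+ p)
  else 0.

Definition root_err p n := 'X - root_iter p n.

(** The cofactor of t - z in t^p - z^p, where z is the iterate. *)
Definition root_fac p n : {poly K} :=
  \sum_(i < p) 'X ^+ (p.-1 - i) * root_iter p n ^+ i.

Lemma root_iterS p n :
  root_iter p n.+1 = root_iter p n + p%:R^-1 *: (root_err p n * root_fac p n).
Proof. by rewrite /= subrXX. Qed.

Lemma root_errS p n :
  root_err p n.+1 = root_err p n * (1 - p%:R^-1 *: root_fac p n).
Proof.
rewrite {1}/root_err root_iterS opprD addrA -/(root_err p n).
by rewrite mulrBr mulr1 scalerAr.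
Qed.

(** The two claims need a joint induction: z <= 1 follows from 1 - z = (1 - t) + e, and then the
    step 1/p is small enough not to overshoot t. *)
Lemma cone_root_iter_err p n : (0 < p)%N ->
  cone (root_iter p n) /\ cone (root_err p n).
Proof.
move=> p0; elim: n => [|n [cz ce]].
  by split; [exact: cone0|rewrite /root_err subr0; exact: coneX].
have cz1 : cone (1 - root_iter p n).
  have -> : 1 - root_iter p n = (1 - 'X) + root_err p n by rewrite /root_err; ring.
  by apply: coneD => //; exact: coneX1.
rewrite root_errS root_iterS; split.
  apply: coneD => //; apply: coneZ; first by rewrite invr_ge0 ler0n.
  apply: coneM => //; apply: cone_sum => i; apply: coneM; apply: coneXn => //.
  exact: coneX.
apply: coneM => //.
(* The cofactor is a sum of p products, each at most 1, so its mean is at most 1. *)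
have -> : 1 - p%:R^-1 *: root_fac p n =
    p%:R^-1 *: \sum_(i < p) (1 - 'X ^+ (p.-1 - i) * root_iter p n ^+ i).
  rewrite big_split/= sumrN scalerBr; congr (_ - _).
  rewrite sumr_const card_ord -scalerMnr scalerMnl -mulr_natr mulVf ?scale1r//.
  by rewrite pnatr_eq0 -lt0n.
apply: coneZ; first by rewrite invr_ge0 ler0n.
apply: cone_sum => i; apply: cone_1subM; last exact: cone_1subXn.
  exact/coneXn/coneX.
by apply: cone_1subXn; [exact: coneX|exact: coneX1].
Qed.

Lemma cone_root_iter p n : (0 < p)%N -> cone (root_iter p n).
Proof. by move=> /(cone_root_iter_err n)[]. Qed.

Lemma cone_root_err p n : (0 < p)%N -> cone (root_err p n).
Proof. by move=> /(cone_root_iter_err n)[]. Qed.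

(* Telescoping: each step moves at least e * 'X ^+ p.-1 / p from the error e to
   the iterate, while the errors decrease. *)
Lemma cone_root_iter_telescope p n : (0 < p)%N ->
  cone (root_iter p n *+ p - (root_err p n * 'X ^+ p.-1) *+ n).
Proof.
move=> p0; have p_neq0 : p%:R != 0 :> K by rewrite pnatr_eq0 -lt0n.
elim: n => [|n IHn]; first by rewrite mul0rn mulr0n subr0; exact: cone0.
have cz := cone_root_iter n p0; have ce := cone_root_err n p0.
have cW : cone (root_fac p n).
  by apply: cone_sum => i; apply: coneM; apply: coneXn => //; exact: coneX.
(* The term i = 0 of [root_fac] is ['X ^+ p.-1]; the others lie in the cone. *)
have cW' : cone (root_fac p n - 'X ^+ p.-1).
  rewrite /root_fac; case: p p0 {p_neq0 IHn cW ce} cz => //= p _ cz.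
  rewrite big_ord_recl subn0 expr0 mulr1 addrC addKr.
  by apply: cone_sum => i; apply: coneM; apply: coneXn => //; exact: coneX.
set z := root_iter p n in IHn cz *; set e := root_err p n in IHn ce *.
set w := root_fac p n in cW cW'.
(* The old difference, plus the gain of the step beyond e t^(p-1), plus n+1 times the decrease of
   the error, weighted by t^(p-1). *)
have -> : root_iter p n.+1 *+ p - (root_err p n.+1 * 'X ^+ p.-1) *+ n.+1 =
  (z *+ p - (e * 'X ^+ p.-1) *+ n) + e * (w - 'X ^+ p.-1) +
  (p%:R^-1 *: (e * w * 'X ^+ p.-1)) *+ n.+1.
  rewrite root_iterS root_errS -/z -/e -/w !(mulrBr e) mulr1 -!scalerAr (scalerAl _ (e * w)).
  set d := _ *: (e * w); have -> : e * w = d *+ p.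
    by rewrite /d scalerMnl -mulr_natr mulVf// scale1r.
  by ring.
by apply: coneD; [apply: coneD => //; exact: coneM|
  apply/coneMn/coneZ; [rewrite invr_ge0 ler0n|
  apply: coneM; [exact: coneM|exact/coneXn/coneX]]].
Qed.

(** Telescoping and z <= 1 give n e t^(p-1) <= p z <= p; then e <= t gives n e^p <= p, and e <= 1
    raises the exponent to m. The four summands in the proof are these inequalities. *)
Lemma cone_root_err_decay p m n : (0 < p)%N -> (p <= m)%N ->
  cone (p%:R - root_err p n ^+ m *+ n).
Proof.
move=> p0 pm; have cz := cone_root_iter n p0; have ce := cone_root_err n p0.
have cG := cone_root_iter_telescope n p0.
set z := root_iter p n in cz cG *; set e := root_err p n in ce cG *.
have ze : 'X = z + e by rewrite /e /root_err -/z; ring.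
have cz1 : cone (1 - z).
  have -> : 1 - z = (1 - 'X) + e by rewrite ze; ring.
  by apply: coneD => //; exact: coneX1.
have ce1 : cone (1 - e).
  have -> : 1 - e = (1 - 'X) + z by rewrite ze; ring.
  by apply: coneD => //; exact: coneX1.
have cXe : cone ('X ^+ p.-1 - e ^+ p.-1).
  apply: cone_subXn => //; first exact: coneX.
  by have -> : 'X - e = z by rewrite ze; ring.
have -> : p%:R - e ^+ m *+ n = (1 - z) *+ p + (z *+ p - (e * 'X ^+ p.-1) *+ n) +
   (e * ('X ^+ p.-1 - e ^+ p.-1)) *+ n + (e ^+ p * (1 - e ^+ (m - p))) *+ n.
  rewrite !mulrBr -exprS prednK// -exprD subnKC//.
  by ring.
apply: coneD; last by apply/coneMn/coneM; [exact: coneXn|exact: cone_1subXn].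
apply: coneD; last by apply/coneMn/coneM.
by apply: coneD => //; exact: coneMn.
Qed.

End Cone.

(** * Positivity and strong convergence for self-adjoint operators *)

Section SelfAdjoint.
Variables (R : realType) (H : hilbertType R).
Implicit Types (x y u v : H).
Local Notation C := R[i].
Local Notation "''[' u , v ]" := (inner u v) : ring_scope.

Lemma inner_inj u v : (forall x, '[x, u] = '[x, v]) -> u = v.
Proof.
move=> uv; apply/eqP; rewrite -subr_eq0 -(dnorm_eq0 (@inner R H)).
by rewrite linearBr/= uv subrr.
Qed.

Lemma innerC u v : '[u, v] = conjC '[v, u].
Proof. by have := hermC (@inner R H) u v; rewrite expr0 mul1r. Qed.

Lemma cvg0_inner (u : nat -> H) :
  (forall e : C, 0 < e ->
    exists N, forall n, (N <= n)%N -> '[u n, u n] <= e) <->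
  u n @[n --> \oo] --> (0 : H).
Proof.
split=> [uP|/cvgr0_norm_le uP e e0].
  apply/cvgr0Pnorm_le => e e0; have [N NP] := uP _ (exprn_gt0 2 e0).
  exists N => // n /NP; rewrite -inner_normE => une.
  by rewrite -(@ler_pXn2r _ 2)// nnegrE ?normr_ge0 ?(ltW e0).
have se0 : 0 < sqrtC e by rewrite sqrtC_gt0.
have [N _ NP] := uP _ se0; exists N => n /NP => une.
by rewrite -inner_normE -[leRHS]sqrtCK ler_pXn2r// ?nnegrE ?(ltW se0).
Qed.

Section Operator.
Variable T : {linear H -> H}.
Implicit Types f g : {poly C}.

Definition evalop_sa f := forall x y, '[evalop T f x, y] = '[x, evalop T f y].

Definition evalop_ge0 f := forall x, 0 <= '[evalop T f x, x].

Lemma evalop_ge0D f g : evalop_ge0 f -> evalop_ge0 g -> evalop_ge0 (f + g).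
Proof. by move=> f0 g0 x; rewrite evalopD linearDl/= addr_ge0 ?f0 ?g0. Qed.

(** The quadratic form of g f g at x is that of f at g(T) x. *)
Lemma evalop_ge0_sandwich f g :
  evalop_sa g -> evalop_ge0 f -> evalop_ge0 (g * f * g).
Proof. by move=> sg f0 x; rewrite !evalopM sg. Qed.

Hypothesis T_sa : forall x y, '[T x, y] = '[x, T y].

Lemma evalop_saX : evalop_sa 'X.
Proof. by move=> x y; rewrite !evalopX. Qed.

Lemma evalop_sa1X : evalop_sa (1 - 'X).
Proof.
move=> x y; rewrite !evalopB -polyC1 !evalopC !evalopX !scale1r.
by rewrite linearBl linearBr/= T_sa.
Qed.

Lemma evalop_saM f g : evalop_sa f -> evalop_sa g -> evalop_sa (f * g).
Proof. by move=> sf sg x y; rewrite evalopM sf sg mulrC evalopM. Qed.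

Lemma cone_evalop_sa f : cone f -> evalop_sa f.
Proof.
elim=> [c c0|{}f g _ sf _ sg|{}f _ sf|{}f _ sf].
- move=> x y; rewrite !evalopC linearZl_LR linearZr_LR/=; congr (_ * _).
  by rewrite conj_Creal// ger0_real.
- by move=> x y; rewrite !evalopD linearDl linearDr/= sf sg.
- by apply: evalop_saM => //; exact: evalop_saX.
- by apply: evalop_saM => //; exact: evalop_sa1X.
Qed.

Hypothesis T_ge0 : forall x, 0 <= '[T x, x].
Hypothesis T_le1 : forall x, '[T x, x] <= '[x, x].

(* The induction needs all four statements: multiplying one of the four
   polynomials by 'X or by 1 - 'X gives a sandwich of another of them, up to
   a sum. *)
Lemma cone_evalop_ge0_strong f : cone f ->
  [/\ evalop_ge0 f, evalop_ge0 ('X * f), evalop_ge0 ((1 - 'X) * f) &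
      evalop_ge0 ('X * (1 - 'X) * f)].
Proof.
have X0 : evalop_ge0 'X by move=> x; rewrite evalopX.
have X10 : evalop_ge0 (1 - 'X).
  move=> x; rewrite evalopB -polyC1 evalopC evalopX scale1r linearBl/=.
  by rewrite subr_ge0.
have sX := evalop_saX; have sX1 := evalop_sa1X.
elim=> [c c0|{}f g _ [f1 f2 f3 f4] _ [g1 g2 g3 g4]|{}f _ [f1 f2 f3 f4]
       |{}f _ [f1 f2 f3 f4]].
- have cZ g : evalop_ge0 g -> evalop_ge0 (g * c%:P).
    by move=> g0 x; rewrite mulrC mul_polyC evalopZ linearZl_LR/= mulr_ge0.
  split; [|exact: cZ|exact: cZ|apply: cZ].
    by rewrite -(mul1r c%:P); apply: cZ => x; rewrite -polyC1 evalopC scale1r dnorm_ge0.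
  (* Multiplying t(1 - t) by t + (1 - t) = 1 splits it into sandwiches of 1 - t and of t. *)
  have -> : 'X * (1 - 'X) = 'X * (1 - 'X) * 'X + (1 - 'X) * 'X * (1 - 'X) :> {poly C}.
    by ring.
  by apply: evalop_ge0D; apply: evalop_ge0_sandwich.
- by split; rewrite ?(mulrDr _ f g); apply: evalop_ge0D.
- split=> //.
  + have -> : 'X * ('X * f) = 'X * f * 'X by ring.
    exact: evalop_ge0_sandwich.
  + by rewrite mulrA (mulrC (1 - 'X)).
  + have -> : 'X * (1 - 'X) * ('X * f) = 'X * ((1 - 'X) * f) * 'X by ring.
    exact: evalop_ge0_sandwich.
- split=> //.
  + by rewrite mulrA.
  + have -> : (1 - 'X) * ((1 - 'X) * f) = (1 - 'X) * f * (1 - 'X) by ring.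
    exact: evalop_ge0_sandwich.
  + have -> : 'X * (1 - 'X) * ((1 - 'X) * f) = (1 - 'X) * ('X * f) * (1 - 'X) by ring.
    exact: evalop_ge0_sandwich.
Qed.

Lemma cone_evalop_ge0 f : cone f -> evalop_ge0 f.
Proof. by case/cone_evalop_ge0_strong. Qed.

(* From ||F^2 x - d x||^2 >= 0 one gets 2 d ||F x||^2 <= ||F^2 x||^2 + d^2 ||x||^2. *)
Lemma evalop_cvg0_sqrt (f : nat -> {poly C}) : (forall n, evalop_sa (f n)) ->
  (forall x, evalop T (f n ^+ 2) x @[n --> \oo] --> (0 : H)) ->
  forall x, evalop T (f n) x @[n --> \oo] --> (0 : H).
Proof.
move=> sf f2 x; apply/cvg0_inner => e e0.
(* With d ||x||^2 <= e and the threshold d e for ||f^2 x||^2, the inequality reads 2 d ||f x||^2 <=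
   2 d e. The [+ 1] covers x = 0. *)
have [d d0 dx] : exists2 d : C, 0 < d & d * '[x, x] <= e.
  have x1 : 0 < '[x, x] + 1 by rewrite ltr_wpDl// dnorm_ge0.
  exists (e / ('[x, x] + 1)); first by rewrite divr_gt0.
  by rewrite mulrAC ler_pdivrMr// ler_pM2l// lerDl.
have [N NP] := (cvg0_inner _).2 (f2 x) _ (mulr_gt0 d0 e0).
exists N => n /NP; rewrite expr2 evalopM.
set y := evalop T _ x; set z := evalop T _ y => zde.
have yz : '[z, x] = '[y, y] by rewrite /z sf.
have zy : '[x, z] = '[y, y] by rewrite /z -sf.
have dC : conjC d = d by rewrite conj_Creal// gtr0_real.
have := dnorm_ge0 (@inner R H) (z - d *: x).
rewrite !(linearBl, linearBr)/= !(linearZl_LR, linearZr_LR)/= dC yz zy.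
move=> h; have {h} : d * '[y, y] + d * '[y, y] <= d * e + d * (d * '[x, x]).
  apply: le_trans (lerD zde (lexx _)).
  rewrite -subr_ge0; apply: le_trans h _; rewrite le_eqVlt; apply/orP; left; apply/eqP.
  by rewrite /GRing.scale/=; ring.
rewrite -!mulrDr ler_pM2l// => h.
have {h dx}: '[y, y] + '[y, y] <= e + e by apply: le_trans h _; rewrite lerD2l.
by rewrite -!mulr2n lerMn2r.
Qed.

(** Halves the exponent k times; powers of a self-adjoint operator are self-adjoint. *)
Lemma evalop_cvg0_root (f : nat -> {poly C}) k : (forall n, evalop_sa (f n)) ->
  (forall x, evalop T (f n ^+ (2 ^ k)) x @[n --> \oo] --> (0 : H)) ->
  forall x, evalop T (f n) x @[n --> \oo] --> (0 : H).
Proof.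
move=> sf; elim: k => [//|k IHk] fk; apply: IHk.
apply: evalop_cvg0_sqrt => [n|x].
  elim: (2 ^ k)%N => [x y|m IHm]; last by rewrite exprS; apply: evalop_saM.
  by rewrite expr0 -polyC1 !evalopC !scale1r.
by have := fk x; under eq_fun do rewrite expnSr exprM.
Qed.

Lemma ubound_nat (c : C) : 0 <= c -> exists N : nat, c <= N%:R.
Proof.
move=> c0; exists (truncn (complex.Re c)).+1.
have -> : c = (complex.Re c)%:C%C by rewrite RRe_real// ger0_real.
rewrite -(rmorph_nat (@real_complex R)) lecR ltW//.
exact: truncnS_gt.
Qed.

Lemma root_err_cvg0 p : (0 < p)%N ->
  forall x, evalop T (root_err C p n) x @[n --> \oo] --> (0 : H).
Proof.
move=> p0; have se n : evalop_sa (root_err C p n) by exact/cone_evalop_sa/cone_root_err.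
(* With g = e_n^(2^p), the decay bound at m = 2^p + 2^p >= p controls <g^2 x, x> = ||g x||^2. *)
apply: (evalop_cvg0_root (k := p)) => // x; apply/cvg0_inner => e e0.
have [|N NP] := @ubound_nat (p%:R * '[x, x] / e).
  by rewrite divr_ge0 ?mulr_ge0 ?ler0n ?dnorm_ge0// ltW.
have pm : (p <= 2 ^ p + 2 ^ p)%N
  by apply: leq_trans (leq_addr _ _); exact/ltnW/ltn_expl.
(* The successor keeps n positive, so that n can be cancelled. *)
exists N.+1 => n Nn.
have := cone_evalop_ge0 (cone_root_err_decay C n p0 pm) x.
rewrite evalopB linearBl/= subr_ge0 -polyC_natr evalopC linearZl_LR/= exprD.
rewrite -mulr_natl -polyC_natr mul_polyC evalopZ linearZl_LR/= evalopM.
set g := root_err C p n ^+ _.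
have -> : '[evalop T g (evalop T g x), x] = '[evalop T g x, evalop T g x].
  apply: cone_evalop_sa; exact/coneXn/cone_root_err.
move=> h; have n0 : 0 < n%:R :> C by rewrite ltr0n (leq_trans _ Nn).
rewrite -(ler_pM2l n0) (le_trans h)//.
move: NP; rewrite ler_pdivrMr// => /le_trans; apply.
by rewrite ler_pM2r// ler_nat ltnW.
Qed.

Lemma comm_root_contraction (B : {linear H -> H}) p : (0 < p)%N ->
  continuous B -> (forall x, B (iter p T x) = iter p T (B x)) ->
  forall x, B (T x) = T (B x).
Proof.
move=> p0 Bcont Bp x; apply/eqP; rewrite -subr_eq0; apply/eqP.
have cz n : evalop_comm T B (root_iter C p n).
  elim: n => [|n IHn]; first by move=> y; rewrite !evalop0 linear0.
  apply: evalop_commD => //; apply: evalop_commZ; rewrite -scaleN1r.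
  apply: evalop_commD; last exact/evalop_commZ/evalop_commXn.
  by move=> y; rewrite !evalopXn.
have eE n y : T y = evalop T (root_err C p n) y + evalop T (root_iter C p n) y.
  by rewrite -evalopD /root_err subrK evalopX.
(* This sequence tends to 0 by continuity of [B]. It is also constant, equal to B T x - T B x,
   because the iterates commute with [B] and cancel. *)
have : (fun n => B (evalop T (root_err C p n) x) - evalop T (root_err C p n) (B x))
    @ \oo --> B 0 - 0.
  apply: cvgB; last exact: root_err_cvg0.
  by apply: continuous_cvg; [exact: Bcont|exact: root_err_cvg0].
rewrite linear0 subr0.
have -> : (fun n => B (evalop T (root_err C p n) x) - evalop T (root_err C p n) (B x))
    = fun=> B (T x) - T (B x).
  apply/funext => n; rewrite (eE n x) (eE n (B x)) linearD cz.
  by rewrite opprD addrACA subrr addr0.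
by move=> /(cvg_unique _ (cvg_cst _)) ->.
Qed.

End Operator.

(** Reduces to the contraction T / b, whose p-th power is b^(-p) T^p. *)
Lemma comm_root (T B : {linear H -> H}) (b : C) p : (0 < p)%N ->
  (forall x y, '[T x, y] = '[x, T y]) -> (forall x, 0 <= '[T x, x]) ->
  0 < b -> (forall x, '[T x, x] <= b * '[x, x]) ->
  continuous B -> (forall x, B (iter p T x) = iter p T (B x)) ->
  forall x, B (T x) = T (B x).
Proof.
move=> p0 Tsa T0 b0 Tb Bcont Bp x.
have bJ : conjC b^-1 = b^-1 by rewrite conj_Creal// gtr0_real// invr_gt0.
have iterZ n y : iter n (b^-1 \*: T) y = b^-1 ^+ n *: iter n T y.
  elim: n y => [|n IHn] y; first by rewrite scale1r.
  by rewrite iterS IHn/= linearZ_LR scalerA -exprS.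
have : B (b^-1 *: T x) = b^-1 *: T (B x).
  apply: (@comm_root_contraction (b^-1 \*: T) _ _ _ B p) => //=.
  - by move=> u v; rewrite linearZl_LR linearZr_LR/= bJ Tsa.
  - by move=> u; rewrite linearZl_LR/= mulr_ge0// invr_ge0 ltW.
  - by move=> u; rewrite linearZl_LR/= ler_pdivrMl.
  - by move=> u; rewrite !iterZ linearZ_LR Bp.
by rewrite linearZ_LR => /scalerI; apply; rewrite invr_eq0 gt_eqF.
Qed.

End SelfAdjoint.

(** * Power identities and commutation for T = A^* A *)

Section Adjoint.
Variables (R : realType) (H : hilbertType R) (A : {linear H -> H}).
Hypothesis A_bounded : bounded_near A (nbhs (0 : H)).
Implicit Types x y : H.
Local Notation "''[' u , v ]" := (inner u v) : ring_scope.
Local Notation A' := (adjoint A).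
Local Notation T := (A' \o A).

Lemma adjoint_is_linear : linear A'.
Proof.
move=> c x y; apply: inner_inj => z.
by rewrite -adjointP// !linearDr/= !linearZr_LR/= -!adjointP.
Qed.

Lemma iter_is_linear (f : H -> H) n : linear f -> linear (iter n f).
Proof. by move=> fL; elim: n => [|n IHn] c x y //; rewrite !iterS IHn fL. Qed.

Lemma adjointA_is_linear : linear T.
Proof. by move=> c x y /=; rewrite linearP adjoint_is_linear. Qed.

Lemma iter_bounded_continuous n : continuous (iter n A).
Proof.
have cA : continuous A by exact/linear_bounded_continuous.
elim: n => [|n IHn] x; first exact: cvg_id.
exact: (continuous_comp (IHn x) (cA _)).
Qed.

Lemma inner_iter_adjoint n x y : '[iter n A x, y] = '[x, iter n A' y].
Proof.
elim: n x y => [//|n IHn] x y.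
by rewrite iterS adjointP// IHn -iterSr.
Qed.

Lemma inner_adjointA x y : '[T x, y] = '[A x, A y].
Proof. by rewrite innerC/= -adjointP// -innerC. Qed.

Lemma adjointA_sa x y : '[T x, y] = '[x, T y].
Proof. by rewrite inner_adjointA adjointP. Qed.

Lemma iter_adjointA_sa n x y : '[iter n T x, y] = '[x, iter n T y].
Proof.
elim: n x y => [//|n IHn] x y.
by rewrite iterS adjointA_sa IHn -iterSr.
Qed.

Lemma adjointA_ge0 x : 0 <= '[T x, x].
Proof. by rewrite inner_adjointA dnorm_ge0. Qed.

Lemma adjointA_bounded : exists2 b : R[i], 0 < b & forall x, '[T x, x] <= b * '[x, x].
Proof.
have /linear_boundedP [r [rr rA]] := A_bounded.
have m0 : 0 < `|r| + 1 by rewrite ltr_wpDl.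
(* Any constant above [r] bounds [A]; this one is also positive. *)
exists ((`|r| + 1) ^+ 2) => [|x]; first by rewrite exprn_gt0.
have Ax : `|A x| <= (`|r| + 1) * `|x|.
  by apply: rA; rewrite (le_lt_trans (real_ler_norm rr))// ltrDl.
by rewrite inner_adjointA -!inner_normE -exprMn ler_pXn2r ?nnegrE// (le_trans _ Ax).
Qed.

Definition adjoint_power_eq s := forall x, iter s A' (iter s A x) = iter s T x.

(** Rewriting T^s as A'^s A^s turns the left side into A'^(s+r) A^(s+r). *)
Lemma iter_adjoint_power r s x : adjoint_power_eq s -> adjoint_power_eq (s + r) ->
  iter r A' (iter s T (iter r A x)) = iter (s + r) T x.
Proof. by move=> es <-; rewrite -es -!iterD addnC. Qed.

(* With D := T^p A^q - A^q T^p, the hypotheses give A'^q D = 0 and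
   A'^q T^p D = 0, hence D^* D = 0. *)
Lemma adjointA_power_comm p q :
  {in [:: p; q; p + q; 2 * p; 2 * p + q]%N, forall s, adjoint_power_eq s} ->
  forall x, iter q A (iter p T x) = iter p T (iter q A x).
Proof.
move=> e x; have [ep eq epq e2p e2pq] : [/\ adjoint_power_eq p, adjoint_power_eq q,
    adjoint_power_eq (p + q), adjoint_power_eq (2 * p) & adjoint_power_eq (2 * p + q)].
  by split; apply: e; rewrite !inE eqxx ?orbT.
rewrite mul2n -addnn in e2p e2pq.
pose D := iter p T (iter q A x) - iter q A (iter p T x).
have A'B n := zmod_morphism_linear (iter_is_linear n adjoint_is_linear).
have TB n := zmod_morphism_linear (iter_is_linear n adjointA_is_linear).
(* Both A'^q T^p A^q and A'^q A^q T^p equal T^(p+q). *)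
have A'D : iter q A' D = 0.
  by rewrite A'B iter_adjoint_power// eq -iterD addnC subrr.
(* Both A'^q T^(2p) A^q and A'^q T^p A^q T^p equal T^(2p+q). *)
have A'TD : iter q A' (iter p T D) = 0.
  rewrite TB A'B -iterD !iter_adjoint_power// -iterD.
  by rewrite addnAC subrr.
apply/esym/eqP; rewrite -subr_eq0 -/D -(dnorm_eq0 (@inner R H)).
(* Expanding the second argument, ||D||^2 = <A'^q T^p D, x> - <A'^q D, T^p x>. *)
rewrite {2}/D linearBr/= -iter_adjointA_sa subr_eq0.
rewrite innerC inner_iter_adjoint A'TD linear0r/= rmorph0.
by rewrite innerC inner_iter_adjoint A'D linear0r/= rmorph0.
Qed.

Lemma adjointA_root_comm r s : (0 < r)%N ->
  (forall x, iter s A (iter r T x) = iter r T (iter s A x)) ->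
  forall x, iter s A (T x) = T (iter s A x).
Proof.
move=> r0 As; have [b b0 Tb] := adjointA_bounded.
pose TL : {linear H -> H} := HB.pack T (GRing.isLinear.Build _ _ _ _ _ adjointA_is_linear).
pose AL : {linear H -> H} := HB.pack (iter s A)
  (GRing.isLinear.Build _ _ _ _ _ (iter_is_linear s (linearP A))).
apply: (@comm_root _ _ TL AL b r) => //=.
- exact: adjointA_sa.
- exact: adjointA_ge0.
- exact: iter_bounded_continuous.
Qed.

(** A'^q (A'^s A^s) A^q = A'^q T^s A^q = A'^q A^q T^s = T^(q+s). *)
Lemma adjoint_power_eqD q s : adjoint_power_eq q ->
  (forall x, iter q A (T x) = T (iter q A x)) ->
  adjoint_power_eq s -> adjoint_power_eq (s + q).
Proof.
move=> eq AT es x; have ATn n : iter q A (iter n T x) = iter n T (iter q A x).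
  by elim: n => [//|n IHn]; rewrite iterS AT IHn.
by rewrite (iterD s q A) (addnC s) (iterD q s A') es -ATn eq -iterD.
Qed.

End Adjoint.

Theorem theorem3p12 (R : realType) (H : hilbertType R) (A : {linear H -> H})
    (p q : nat) :
  bounded_near A (nbhs (0 : H)) ->
  (0 < p)%N -> (0 < q)%N ->
  (forall s : nat, s \in [:: p; q; (p + q)%N; (2 * p)%N; (2 * p + q)%N] ->
     iter s (adjoint A) \o iter s A =1 iter s (adjoint A \o A)) ->
  quasinormal A.
Proof.
move=> A_bounded p0 q0 e.
have eq : adjoint_power_eq A q by apply: e; rewrite !inE eqxx orbT.
have AqT := adjointA_root_comm A_bounded p0 (adjointA_power_comm A_bounded e).
have step s := @adjoint_power_eqD _ _ A q s eq AqT.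
(* The exponent 1 holds by definition of T; steps of size q from 1 and from q reach every exponent
   required for the pair (q, 1). *)
have e1q : adjoint_power_eq A (q + 1) by rewrite addnC; exact: step.
have e2q : adjoint_power_eq A (2 * q) by rewrite mul2n -addnn; exact: step.
have e2q1 : adjoint_power_eq A (2 * q + 1).
  by rewrite mul2n -addnn addnAC; exact: step.
have {}e : {in [:: q; 1; q + 1; 2 * q; 2 * q + 1]%N,
    forall s, adjoint_power_eq A s}.
  by move=> s; rewrite !inE => /or4P[| | |/orP[]] /eqP->.
(* Second pass: A commutes with T^q, hence with T. *)
move=> x; exact: (adjointA_root_comm A_bounded q0 (adjointA_power_comm A_bounded e)).
Qed.
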